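(* Let $A$ be an algebra over a field $K$ whose group of units $U(A)$ satisfies a Laurent polynomial identity over $K$, and let $f\in K[X]$ be a non-zero polynomial of degree $d$ such that $f(b'a'c'u)=0$ for all $a',b',c',u\in A$ with $a'^2=b'c'=0$. Let $a,b\in A$ be such that $a^2=b^2=0$. \begin{enumerate} \item If $|K|>2d$, then $(ab)^{2d}=0$. \item If $ab$ is nilpotent, then $(ab)^{2d}=0$. \end{enumerate}
   Context: Algebras are associative with unit; $U(A)$ is the group of units of $A$. Let $F=\langle x_1,\dots,x_m\rangle$ be a free group. A Laurent polynomial identity (LPI) over $K$ for $U(A)$ is a non-zero element $P$ of the group algebra $KF$ such that $P(c_1,\dots,c_m)=0$ in $A$ for all $c_1,\dots,c_m\in U(A)$. Throughout, an LPI is assumed to be of the form $P=a_1+a_2w_2+\cdots+a_tw_t$ with $t\ge 2$, all $a_i\in K$ non-zero (in particular $a_1\neq 0$), and $w_2,\dots,w_t$ distinct non-trivial words in $F$, such that each $w_i$ has non-zero sum of exponents in at least one of the variables $x_j$. Under these hypotheses a polynomial $f$ as in the claim always exists. *)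

(* Defs.v *)
From HB Require Import structures.
From mathcomp Require Import all_boot all_order all_algebra.
From mathcomp Require Import finmap.
From mathcomp.multinomials Require Import monalg.

Set Implicit Arguments.
Unset Strict Implicit.
Unset Printing Implicit Defensive.

Import GRing.Theory.
Local Open Scope ring_scope.

(* The letter (i, false) is the generator x_i, and (i, true) is x_i^-1. *)
Definition letter (m : nat) : Type := ('I_m * bool)%type.
HB.instance Definition _ m := Finite.on (letter m).

Definition linv m (l : letter m) : letter m := (l.1, ~~ l.2).

Definition reduced m (w : seq (letter m)) : bool :=
  sorted (fun k l => l != linv k) w.

(* The free group on x_0, ..., x_(m-1), with reduced words as normal forms. *)
Record freegroup (m : nat) : Type :=
  FreeGroup { fgword :> seq (letter m); _ : reduced fgword }.
HB.instance Definition _ m := [isSub for @fgword m].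
HB.instance Definition _ m := [Choice of freegroup m by <:].

Section FreeGroup.
Variable m : nat.
Implicit Types (k l : letter m) (u v w : seq (letter m)).

Definition push l w :=
  if w is k :: w' then if k == linv l then w' else l :: w else [:: l].

Lemma linvK : involutive (@linv m).
Proof. by case=> i b; rewrite /linv /= negbK. Qed.

Lemma reduced_tail l w : reduced (l :: w) -> reduced w.
Proof. exact: path_sorted. Qed.

Lemma push_reduced l w : reduced w -> reduced (push l w).
Proof.
case: w => //= k w rw; case: eqP => [_|/eqP nk]; first exact: reduced_tail rw.
by rewrite /reduced /= nk.
Qed.

Lemma push_id l w : reduced (l :: w) -> push l w = l :: w.
Proof. by case: w => //= k w; rewrite /reduced /= => /andP[/negPf->]. Qed.

Lemma pushK l w : reduced w -> push l (push (linv l) w) = w.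
Proof.
case: w => [|k w] rw /=; first by rewrite eqxx.
by rewrite linvK; case: eqP => [<-|_] /=; [exact: push_id | rewrite eqxx].
Qed.

Definition wmul u v := foldr push v u.

Lemma wmul_reduced u v : reduced v -> reduced (wmul u v).
Proof. by move=> rv; elim: u => //= l u; apply: push_reduced. Qed.

Lemma wmul0 u : reduced u -> wmul u [::] = u.
Proof.
elim: u => //= l u IHu ru; rewrite IHu ?push_id //; exact: reduced_tail ru.
Qed.

Lemma wmul_push l u v : reduced v -> wmul (push l u) v = push l (wmul u v).
Proof.
case: u => //= k u rv; case: eqP => [->|//].
by rewrite pushK // wmul_reduced.
Qed.

Lemma wmulA u v w : reduced w -> wmul u (wmul v w) = wmul (wmul u v) w.
Proof. by move=> rw; elim: u => //= l u ->; rewrite wmul_push. Qed.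

Definition winv w := rev (map (@linv m) w).

Lemma winv_reduced w : reduced w -> reduced (winv w).
Proof.
rewrite /reduced /winv rev_sorted sorted_map; apply: sub_sorted => k l /=.
by rewrite linvK; apply: contraNneq => <-.
Qed.

Lemma winvK : involutive winv.
Proof. by move=> w; rewrite /winv map_rev revK mapK //; apply: linvK. Qed.

Lemma wmulV w : wmul (winv w) w = [::].
Proof.
elim: w => //= l w; rewrite /winv /= rev_cons /wmul -cats1 foldr_cat /=.
by rewrite linvK eqxx.
Qed.

Definition fgone : freegroup m := @FreeGroup m [::] isT.
Definition fgmul (u v : freegroup m) : freegroup m :=
  FreeGroup (wmul_reduced u (valP v)).
Definition fginv (w : freegroup m) : freegroup m :=
  FreeGroup (winv_reduced (valP w)).

Lemma fgmulA : associative fgmul.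
Proof. by move=> u v w; apply/val_inj/wmulA/(valP w). Qed.

Lemma fg1mul : left_id fgone fgmul.
Proof. by move=> w; apply: val_inj. Qed.

Lemma fgmul1 : right_id fgone fgmul.
Proof. by move=> w; apply/val_inj/wmul0/(valP w). Qed.

Lemma fgmulV : left_inverse fgone fginv fgmul.
Proof. by move=> w; apply/val_inj/wmulV. Qed.

Lemma fgVmul : right_inverse fgone fginv fgmul.
Proof.
by move=> w; apply/val_inj; rewrite /= -{1}[fgword w]winvK wmulV.
Qed.

HB.instance Definition _ :=
  isGroup.Build (freegroup m) fgmulA fg1mul fgmul1 fgmulV fgVmul.

Definition expsum (j : 'I_m) (w : freegroup m) : int :=
  \sum_(l <- fgword w | l.1 == j) (-1) ^+ l.2.

Definition fgeval (A : unitRingType) (c : 'I_m -> A) (w : freegroup m) : A :=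
  \prod_(l <- fgword w) (if l.2 then (c l.1)^-1 else c l.1).

End FreeGroup.

(* The group algebra KF is {malg K[F]}, the finitely supported functions on F. *)
(* Its product, which monalg does not define over a group, is not needed.      *)
Section LPI.
Variables (K : fieldType) (m : nat).
Implicit Type P : {malg K[freegroup m]}.

Definition lpeval (A : unitAlgType K) (c : 'I_m -> A) P : A :=
  mmap (GRing.in_alg A) (fgeval c) P.

Definition is_LPI (A : unitAlgType K) P : Prop :=
  P <> 0 /\
  forall c : 'I_m -> A, (forall j, c j \is a GRing.unit) -> lpeval c P = 0.

(* P = a_1 + a_2 w_2 + ... + a_t w_t where t >= 2, the a_i are non-zero, and   *)
(* the w_i are distinct, non-trivial, each with some non-zero exponent sum.    *)
Definition LPI_form P : Prop :=
  [/\ P@_(1%g) != 0,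
      (2 <= #|` msupp P|)%N
    & forall w : freegroup m, w \in msupp P -> w != 1%g ->
        exists j : 'I_m, expsum j w != 0].

End LPI.

Definition units_satisfy_LPI (K : fieldType) (A : unitAlgType K) : Prop :=
  exists (m : nat) (P : {malg K[freegroup m]}), is_LPI A P /\ LPI_form P.

(* Main.v *)
Require Import Defs.
From HB Require Import structures.
From mathcomp Require Import all_boot all_order all_algebra.

Import GRing.Theory.
Local Open Scope ring_scope.

(** The point is to choose a' = b, b' = c' = a: then a'^2 = b^2 = 0 and
    b' c' = a^2 = 0, so [f] annihilates [a * b * a * u] for every [u].  With
    [u] a scalar multiple of [b] this says that [f] annihilates every scalar
    multiple of x = (ab)^2, and it remains to see that x^d = 0.

    If the field has more than [d] elements, f(tx) is a polynomial in the
    scalar [t], with coefficients f_i x^i in the algebra, having more roots than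
    its degree; so its leading coefficient f_d x^d vanishes
    ([horner_alg_scale_eq0_exp]).

    If [x] is nilpotent, write f = g X^k with g(0) <> 0.  Then g(x) is
    invertible, whence x^k = 0 with k <= d ([horner_alg_nilpotent_exp]). *)

(** Over a noncommutative ring a nonzero polynomial may have too many roots, but
    not when they commute and have invertible differences, as distinct scalars
    do; this is why the bound on the number of roots applies to the polynomial
    with coefficients f_i x^i. *)
Lemma horner_alg_scale_eq0_exp (K : fieldType) (A : unitAlgType K)
    (f : {poly K}) (x : A) (s : seq K) :
    f != 0 -> uniq s -> (size f <= size s)%N ->
    (forall t, t \in s -> horner_alg (t *: x) f = 0) ->
  x ^+ (size f).-1 = 0.
Proof.
move=> f0 us fs fx.
pose P : {poly A} := \poly_(i < size f) (f`_i *: x ^+ i).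
have rootP : all (root P) [seq t%:A | t <- s].
  apply/allP => _ /mapP[t ts ->]; apply/eqP; rewrite horner_poly.
  apply: etrans (fx t ts); rewrite /horner_alg /horner_morph.
  rewrite (@horner_coef_wide _ (size f)) ?size_poly //.
  apply: eq_bigr => i _; rewrite coef_map /= !exprZn expr1n.
  by rewrite mulr_algr mulr_algl !scalerA mulrC.
have uniqP : uniq_roots [seq (t%:A : A) | t <- s].
  elim: s us {fs fx rootP} => //= t s IHs /andP[ts us]; rewrite IHs // andbT.
  apply/allP => _ /mapP[r rs ->]; rewrite /diff_roots.
  rewrite mulr_algl mulr_algr !scalerA mulrC eqxx -scalerBl /=.
  rewrite -in_algE; apply: rmorph_unit; rewrite unitfE subr_eq0.
  by apply: contraNneq ts => <-.
have P0 : P = 0.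
  apply/eqP/negPn/negP => /max_ring_poly_roots/(_ rootP uniqP).
  by rewrite size_map ltnNge (leq_trans (size_poly _ _)).
have /eqP: P`_(size f).-1 = 0 by rewrite P0 coef0.
rewrite coef_poly prednK ?size_poly_gt0 // leqnn -/(lead_coef f).
by rewrite scaler_eq0 lead_coef_eq0 (negPf f0) => /eqP.
Qed.

(** The factor of [f] prime to X takes an invertible value at a nilpotent
    element, by a Bezout relation with X^n; what is left is X^k = 0 with [k]
    the multiplicity of the root 0. *)
Lemma horner_alg_nilpotent_exp (K : fieldType) (A : algType K)
    (f : {poly K}) (x : A) (n : nat) :
    f != 0 -> x ^+ n = 0 -> horner_alg x f = 0 ->
  x ^+ (size f).-1 = 0.
Proof.
move=> f0 xn fx; have [k [g]] := multiplicity_XsubC f 0.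
rewrite f0 subr0 /= => g0 fE.
have kd : (k <= (size f).-1)%N.
  have gn0 : g != 0 by apply: contraNneq g0 => ->; rewrite root0.
  rewrite fE size_Mmonic ?monicXn // size_polyXn addnS /=.
  move: gn0; rewrite -size_poly_gt0.
  by case: (size g) => // r _; rewrite addSn leq_addl.
have /Bezout_eq1_coprimepP[[u v] /= uv1] : coprimep g 'X^n.
  by rewrite coprimep_expr // -['X]subr0 coprimep_XsubC.
have gx : horner_alg x u * horner_alg x g = 1.
  have /(congr1 (horner_alg x)) := uv1.
  by rewrite rmorphD !rmorphM rmorph1 rmorphXn /= horner_algX xn mulr0 addr0.
have gxk : horner_alg x g * x ^+ k = 0.
  by rewrite -fx fE rmorphM rmorphXn /= horner_algX.
have xk : x ^+ k = 0 by rewrite -[x ^+ k]mul1r -gx -mulrA gxk mulr0.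
by rewrite -(subnKC kd) exprD xk mul0r.
Qed.

Theorem corollary2p3 (K : fieldType) (A : unitAlgType K) (f : {poly K}) (d : nat)
    (hLPI : units_satisfy_LPI A)
    (hf0 : f != 0)
    (hfd : size f = d.+1)
    (hf : forall a' b' c' u : A, a' ^+ 2 = 0 -> b' * c' = 0 ->
            horner_alg (b' * a' * c' * u) f = 0)
    (a b : A) (ha : a ^+ 2 = 0) (hb : b ^+ 2 = 0) :
  ((exists s : seq K, uniq s /\ (2 * d < size s)%N) ->
     (a * b) ^+ (2 * d) = 0) /\
  ((exists n : nat, (a * b) ^+ n = 0) -> (a * b) ^+ (2 * d) = 0).
Proof.
have fab t : horner_alg (t *: (a * b) ^+ 2) f = 0.
  have aa : a * a = 0 by rewrite -expr2.
  by have := hf b a a (t *: b) hb aa; rewrite -scalerAr expr2 !mulrA.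
have -> : d = (size f).-1 by rewrite hfd.
rewrite exprM; split=> [[s [us ds]]|[n abn]].
  apply: (@horner_alg_scale_eq0_exp _ _ _ _ s) => //.
  by rewrite (leq_trans _ ds) // hfd ltnS mul2n -addnn leq_addr.
apply: (@horner_alg_nilpotent_exp _ _ _ _ n) => //.
  by rewrite -exprM mulnC exprM abn expr0n.
by rewrite -[_ ^+ 2]scale1r fab.
Qed.
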